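(* Let $R$ be any (associative, not necessarily unital) ring. Then: (i) The pair $\mathrm S\mathcal Q(R)=(\Lambda(R),\mathrm S(R))$ is an object of the category $\mathrm S\mathcal Q$. (ii) The assignment $R\mapsto \mathrm S\mathcal Q(R)$ defines a functor $\mathrm S\mathcal Q\colon \mathrm{Rings}\to \mathrm S\mathcal Q$ (sending a ring homomorphism $f\colon R\to R'$ to the map $\Lambda(f)\colon[(x_n)]\mapsto[(f(x_n))]$).
   Context: $\mathrm{Rings}$ is the category of associative, not necessarily unital rings and ring homomorphisms. $M_\infty(R)$ is the ring of infinite matrices over $R$ with finitely many nonzero entries. For $x,y\in M_\infty(R)$, $x\precsim_1 y$ means $x=syt$ for some $s,t\in M_\infty(R)$. $x\oplus y$ denotes the infinite matrix represented by the block diagonal matrix $\mathrm{diag}(x,y)$, where $x,y$ are replaced by finite square upper-left corners containing all their nonzero entries. $T(R)=\{(x_n)_{n\ge1}: x_n\in M_\infty(R),\ x_n\precsim_1 x_{n+1}\ \forall n\}$, and $\mathcal S(R)=\{(x_n)\in T(R): \forall n\ \exists y_{n+1}\in M_\infty(R),\ x_n=y_{n+1}x_{n+1}x_n\}$. For $(x_n),(y_n)\in T(R)$ write $(x_n)\precsim(y_n)$ if for every $n$ there is $m$ with $x_n\precsim_1 y_m$, and $(x_n)\sim(y_n)$ if $(x_n)\precsim (y_n)$ and $(y_n)\precsim(x_n)$. Put $\Lambda(R)=T(R)/{\sim}$ and $\mathrm S(R)=\mathcal S(R)/{\sim}\subseteq\Lambda(R)$, with the order induced by $\precsim$ and addition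 $[(x_n)]+[(y_n)]=[(x_n\oplus y_n)]$; these are positively ordered commutative monoids. On $\Lambda(R)$ one considers the auxiliary relation $[(x_n)]\prec[(y_n)]$ iff there is $m$ with $x_n\precsim_1 y_m$ for all $n$. An auxiliary relation $\prec$ on a partially ordered set is a relation with $x\prec y\Rightarrow x\le y$, and such that $x'\le x\prec y\le y'$ implies $x'\prec y'$; on a monoid it is additive if $0\prec x$ for all $x$ and $x_1\prec y_1$, $x_2\prec y_2$ imply $x_1+x_2\prec y_1+y_2$. A $\mathcal Q$-semigroup is a positively ordered monoid with an additive auxiliary relation satisfying: (O1) increasing sequences have suprema; (O4) $\sup_n(x_n+y_n)=\sup_n x_n+\sup_n y_n$ for increasing sequences. A $\mathcal Q$-morphism is a monoid morphism preserving the auxiliary relation and suprema of increasing sequences. ($\Lambda(R)$ with $\prec$ above is a $\mathcal Q$-semigroup.) A sequence $(x_n)$ in a $\mathcal Q$-semigroup $S$ is weakly increasing if there is an increasing sequence $(y_m)$ in $S$ such that for every $m$ there is $n(m)$ with $y_m\le x_n$ for all $n\ge n(m)$, and $x_n\le \sup_m y_m$ for every $n$ (then $\sup_n x_n=\sup_m y_m$). The category $\mathrm S\mathcal Q$ has as objects pairs $(S,W)$ with $S$ a $\mathcal Q$-semigroup and $W$ a submonoid of $S$ such that the supremum of any sequence in $W$ that is weakly increasing in $S$ belongs to $W$; morphisms $(S_1,W_1)\to(S_2,W_2)$ are $\mathcal Q$-morphisms $f\colon S_1\to S_2$ with $f(W_1)\subseteq W_2$. *)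

(* Defs.v *)
From HB Require Import structures.
From mathcomp Require Import all_boot all_order all_algebra.
From mathcomp Require Import generic_quotient.
From mathcomp Require Import mathcomp_extra boolp classical_sets functions.
From mathcomp Require Import cardinality fsbigop.

Set Implicit Arguments.
Unset Strict Implicit.
Unset Printing Implicit Defensive.

Import Order.TTheory GRing.Theory.

Local Open Scope classical_set_scope.
Local Open Scope quotient_scope.
Local Open Scope ring_scope.

Record category := Category {
  ob :> Type;
  hom : ob -> ob -> Type;
  id_hom : forall a, hom a a;
  comp_hom : forall a1 a2 a3, hom a2 a3 -> hom a1 a2 -> hom a1 a3;
  comp_hom_idl : forall a b (f : hom a b), comp_hom (id_hom b) f = f;
  comp_hom_idr : forall a b (f : hom a b), comp_hom f (id_hom a) = f;
  comp_homA : forall a b c d (f : hom a b) (g : hom b c) (h : hom c d),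
    comp_hom h (comp_hom g f) = comp_hom (comp_hom h g) f
}.
Arguments hom {_} _ _.
Arguments id_hom {_} a.
Arguments comp_hom {_ a1 a2 a3} _ _.

Record is_functor (C D : category) (F0 : C -> D)
    (F1 : forall a b : C, hom a b -> hom (F0 a) (F0 b)) : Prop := IsFunctor {
  functor_id : forall a, F1 a a (id_hom a) = id_hom (F0 a);
  functor_comp : forall a b c (g : hom b c) (f : hom a b),
    F1 a c (comp_hom g f) = comp_hom (F1 b c g) (F1 a b f)
}.

HB.mixin Record Zmodule_isRng R of GRing.Zmodule R := {
  rmul : R -> R -> R;
  rmulA : associative rmul;
  rmulDl : left_distributive rmul +%R;
  rmulDr : right_distributive rmul +%R
}.
#[short(type="rngType")]
HB.structure Definition Rng := {R of Zmodule_isRng R & GRing.Zmodule R}.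

Notation "x ** y" := (rmul x y) (at level 40, left associativity) : ring_scope.

Record rng_hom (R R' : rngType) := RngHom {
  rng_fun :> R -> R';
  rng_homD : {morph rng_fun : x y / x + y};
  rng_homM : {morph rng_fun : x y / x ** y}
}.

Lemma rng_hom_ext (R R' : rngType) (f g : rng_hom R R') : f =1 g -> f = g.
Proof.
case: f g => f fD fM [g gD gM] /= /funext fg; case: g / fg in gD gM *.
by rewrite (Prop_irrelevance fD gD) (Prop_irrelevance fM gM).
Qed.

Definition rng_id (R : rngType) : rng_hom R R :=
  @RngHom R R id (fun _ _ => erefl) (fun _ _ => erefl).

Lemma rng_compD (R1 R2 R3 : rngType) (g : rng_hom R2 R3) (f : rng_hom R1 R2) :
  {morph g \o f : x y / x + y}.
Proof. by move=> x y /=; rewrite !rng_homD. Qed.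

Lemma rng_compM (R1 R2 R3 : rngType) (g : rng_hom R2 R3) (f : rng_hom R1 R2) :
  {morph g \o f : x y / x ** y}.
Proof. by move=> x y /=; rewrite !rng_homM. Qed.

Definition rng_comp (R1 R2 R3 : rngType) (g : rng_hom R2 R3)
  (f : rng_hom R1 R2) : rng_hom R1 R3 := RngHom (rng_compD g f) (rng_compM g f).

Definition Rings : category.
Proof.
refine (@Category rngType rng_hom rng_id rng_comp _ _ _);
  by move=> *; exact: rng_hom_ext.
Defined.

Section RngTheory.
Variable R : rngType.
Implicit Types x y : R.

Lemma rmul0l x : 0 ** x = 0.
Proof. by apply: (addrI (0 ** x)); rewrite -rmulDl !addr0. Qed.

Lemma rmul0r x : x ** 0 = 0.
Proof. by apply: (addrI (x ** 0)); rewrite -rmulDr !addr0. Qed.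

Lemma rmul_suml I (r : seq I) (F : I -> R) y :
  (\sum_(i <- r) F i) ** y = \sum_(i <- r) F i ** y.
Proof. by apply: (big_morph (rmul^~ y)) => [a b|]; rewrite ?rmulDl ?rmul0l. Qed.

Lemma rmul_sumr I (r : seq I) (F : I -> R) y :
  y ** (\sum_(i <- r) F i) = \sum_(i <- r) y ** F i.
Proof. by apply: (big_morph (rmul y)) => [a b|]; rewrite ?rmulDr ?rmul0r. Qed.

Lemma rng_hom0 (R' : rngType) (f : rng_hom R R') : f 0 = 0.
Proof. by apply: (addrI (f 0)); rewrite -rng_homD !addr0. Qed.

Lemma rng_hom_sum (R' : rngType) (f : rng_hom R R') I (r : seq I) (F : I -> R) :
  f (\sum_(i <- r) F i) = \sum_(i <- r) f (F i).
Proof. by apply: big_morph; [exact: rng_homD | exact: rng_hom0]. Qed.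

End RngTheory.

Record Minf (R : rngType) := MkMinf {
  entry :> nat -> nat -> R;
  entry_finite : finite_set [set ij : nat * nat | entry ij.1 ij.2 != 0]
}.

Section Minf.
Variable R : rngType.
Implicit Types (x y z s t : Minf R) (N i j : nat).

Lemma Minf_ext x y : (forall i j, x i j = y i j) -> x = y.
Proof.
case: x y => x fx [y fy] /= xy.
have {}xy : x = y by apply/funext => i; apply/funext => j.
by case: y / xy in fy *; rewrite (Prop_irrelevance fx fy).
Qed.

(* All nonzero entries lie in the N x N upper-left corner. *)
Definition corner N (x : nat -> nat -> R) :=
  forall i j, x i j != 0 -> (i < N)%N /\ (j < N)%N.

Lemma corner_finite N (x : nat -> nat -> R) :
  corner N x -> finite_set [set ij : nat * nat | x ij.1 ij.2 != 0].
Proof.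
move=> xN; apply: (@sub_finite_set _ _ (`I_N `*` `I_N)).
  by move=> [i j] /= /xN.
exact: finite_setX.
Qed.

Lemma corner_ex x : exists N, corner N x.
Proof.
have /finite_seqP[A xA] := entry_finite x.
exists (\max_(ij <- A) (maxn ij.1 ij.2)).+1 => i j xij.
have ijA : (i, j) \in A by have : [set` A] (i, j) by rewrite -xA.
have := @leq_bigmax_seq _ A xpredT
  (fun ij => maxn ij.1 ij.2) (i, j) ijA isT.
by rewrite /= geq_max => /andP[].
Qed.

Lemma corner_leq N N' (x : nat -> nat -> R) :
  (N <= N')%N -> corner N x -> corner N' x.
Proof. by move=> NN' xN i j /xN[iN jN]; rewrite !(leq_trans _ NN'). Qed.

Lemma corner0 N (x : nat -> nat -> R) i j :
  corner N x -> (N <= i)%N || (N <= j)%N -> x i j = 0.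
Proof.
by move=> xN; apply: contraTeq => /xN[]; rewrite negb_or -!ltnNge => -> ->.
Qed.

(* For finitely supported x and y the sum has finite support; [\sum_(_ \in _)]
   is the sum over that support. *)
Definition Minf_mul_fun x y i j : R := \sum_(k \in [set: nat]) x i k ** y k j.

Lemma Minf_mul_funE N x y i j : corner N x \/ corner N y ->
  Minf_mul_fun x y i j = \sum_(k <- iota 0 N) x i k ** y k j.
Proof.
move=> xy; rewrite /Minf_mul_fun [RHS]fsbig_seq ?iota_uniq//.
apply/esym/fsbig_widen => // k [_] /=; rewrite mem_iota add0n leq0n /= => /negP.
rewrite -leqNgt => Nk; case: xy => [/corner0->|/corner0->];
  by rewrite ?Nk ?orbT ?rmul0l ?rmul0r.
Qed.

Lemma Minf_mul_corner N x y : corner N x -> corner N y ->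
  corner N (Minf_mul_fun x y).
Proof.
move=> xN yN i j; rewrite (@Minf_mul_funE N); last by left.
move=> xy; split; rewrite ltnNge; apply: contra xy => Nij.
  by rewrite big1// => k _; rewrite (corner0 xN) ?Nij// rmul0l.
by rewrite big1// => k _; rewrite (corner0 yN) ?Nij ?orbT// rmul0r.
Qed.

Lemma corner_ex2 x y : exists2 N, corner N x & corner N y.
Proof.
have [[N xN] [M yM]] := (corner_ex x, corner_ex y).
exists (maxn N M); first exact: corner_leq (leq_maxl _ _) xN.
exact: corner_leq (leq_maxr _ _) yM.
Qed.

Lemma Minf_mul_finite x y :
  finite_set [set ij : nat * nat | Minf_mul_fun x y ij.1 ij.2 != 0].
Proof.
have [N xN yN] := corner_ex2 x y.
exact: corner_finite (Minf_mul_corner xN yN).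
Qed.

Definition Minf_mul x y : Minf R := MkMinf (Minf_mul_finite x y).

Lemma Minf_mulE N x y i j : corner N x \/ corner N y ->
  Minf_mul x y i j = \sum_(k <- iota 0 N) x i k ** y k j.
Proof. exact: Minf_mul_funE. Qed.

Lemma Minf_mulA : associative Minf_mul.
Proof.
move=> x y z; apply: Minf_ext => i j.
have [N xN zN] := corner_ex2 x z.
rewrite (@Minf_mulE N x); last by left.
rewrite (@Minf_mulE N _ z); last by right.
have yzE k := @Minf_mulE N y z k j (or_intror zN).
have xyE k := @Minf_mulE N x y i k (or_introl xN).
under eq_bigr do rewrite yzE rmul_sumr.
under [RHS]eq_bigr do rewrite xyE rmul_suml.
rewrite exchange_big; apply: eq_bigr => k _; apply: eq_bigr => l _.
by rewrite rmulA.
Qed.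

Lemma Minf0_finite :
  finite_set [set ij : nat * nat | (fun _ _ => 0 : R) ij.1 ij.2 != 0].
Proof. by apply: (@corner_finite 0) => i j /=; rewrite eqxx. Qed.

Definition Minf0 : Minf R := MkMinf Minf0_finite.

(* The block diagonal matrix diag(x, y), where x is replaced by its N x N
   upper-left corner. *)
Definition block_fun N x y i j : R :=
  if (i < N)%N && (j < N)%N then x i j
  else if (N <= i)%N && (N <= j)%N then y (i - N)%N (j - N)%N
  else 0.

Lemma block_finite N x y :
  finite_set [set ij : nat * nat | block_fun N x y ij.1 ij.2 != 0].
Proof.
have [M yM] := corner_ex y.
apply: (@corner_finite (N + M)) => i j; rewrite /block_fun.
case: ifP => [/andP[iN jN] _|_]; first by rewrite !ltn_addr.
case: ifP => [/andP[iN jN] /yM|]; last by rewrite eqxx.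
by rewrite !ltn_subLR.
Qed.

Definition block N x y : Minf R := MkMinf (block_finite N x y).

(* The size of the corner is immaterial: see [pi_block] below. *)
Definition oplus x y : Minf R := block (xget 0%N [set N | corner N x]) x y.

Lemma oplus_corner x : corner (xget 0%N [set N | corner N x]) x.
Proof. exact: (xgetPex 0%N (corner_ex x)). Qed.

Definition lesim1 x y := exists s t, x = Minf_mul (Minf_mul s y) t.

Lemma lesim1_trans x y z : lesim1 x y -> lesim1 y z -> lesim1 x z.
Proof.
move=> [s [t ->]] [s' [t' ->]].
by exists (Minf_mul s s'), (Minf_mul t' t); rewrite !Minf_mulA.
Qed.

Lemma lesim1_0 x : lesim1 Minf0 x.
Proof.
exists Minf0, Minf0; apply: Minf_ext => i j.
by rewrite (@Minf_mulE 0%N) ?big_nil//; right => ? ? /=; rewrite eqxx.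
Qed.

Let pick (b : bool) x y := if b then y else x.

(* [l i] gives the block to which the index [i] belongs and its position. *)
Let relabel (l : nat -> bool * nat) x y i j : R :=
  if (l i).1 == (l j).1 then pick (l i).1 x y (l i).2 (l j).2 else 0.

Lemma sum_label (m : nat -> bool * nat) b (G : nat -> R) : injective m ->
  (forall k, G k != 0 -> exists c, m c = (b, k)) ->
  \sum_(c \in [set: nat]) (if b == (m c).1 then G (m c).2 else 0) =
  \sum_(k \in [set: nat]) G k.
Proof.
move=> minj Gm; pose P := [set c | b = (m c).1].
transitivity (\sum_(c \in P) G (m c).2).
  transitivity (\sum_(c \in P) (if b == (m c).1 then G (m c).2 else 0)).
    by apply/esym/fsbig_widen => // c [_] /= /eqP/negbTE; rewrite eq_sym => ->.
  by apply: eq_fsbigr => c /set_mem Pc /=; rewrite ifT//; apply/eqP.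
rewrite -(@fsbig_image _ _ _ _ _ P (fun c => (m c).2) G).
  apply: fsbig_widen => // k [_] /= mk; apply: contra_notP mk => /eqP/Gm[c mc].
  by exists c; rewrite /P /= mc.
move=> c d /set_mem /= Pc /set_mem /= Pd cd; apply: minj.
by rewrite (surjective_pairing (m c)) (surjective_pairing (m d)) cd -[(m c).1]Pc -[(m d).1]Pd.
Qed.

Lemma lesim1_relabel (l m : nat -> bool * nat) x x' y y' z z' : injective m ->
  (forall k j, x' k j != 0 \/ x' j k != 0 -> exists c, m c = (false, k)) ->
  (forall k j, y' k j != 0 \/ y' j k != 0 -> exists c, m c = (true, k)) ->
  (forall i j, z i j = relabel l x y i j) ->
  (forall i j, z' i j = relabel m x' y' i j) ->
  lesim1 x x' -> lesim1 y y' -> lesim1 z z'.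
Proof.
move=> minj cx cy zE z'E [s1 [t1 xE]] [s2 [t2 yE]].
have [K zK z'K] := corner_ex2 z z'.
pose S i c : R := if (i < K)%N && (c < K)%N && ((l i).1 == (m c).1)
  then pick (l i).1 s1 s2 (l i).2 (m c).2 else 0.
pose T c j : R := if (c < K)%N && (j < K)%N && ((m c).1 == (l j).1)
  then pick (l j).1 t1 t2 (m c).2 (l j).2 else 0.
have SK : corner K S.
  by move=> i c; rewrite /S; case: ifP => [/andP[/andP[]]//|]; rewrite eqxx.
have TK : corner K T.
  by move=> i c; rewrite /T; case: ifP => [/andP[/andP[]]//|]; rewrite eqxx.
exists (MkMinf (corner_finite SK)), (MkMinf (corner_finite TK)).
have cover b k j : pick b x' y' k j != 0 \/ pick b x' y' j k != 0 ->
    exists c, m c = (b, k) by case: b => /=; [exact: cy | exact: cx].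
have SzE i d : (i < K)%N -> Minf_mul (MkMinf (corner_finite SK)) z' i d =
    if (l i).1 == (m d).1 then
      Minf_mul (pick (l i).1 s1 s2) (pick (l i).1 x' y') (l i).2 (m d).2 else 0.
  move=> iK; rewrite /= /Minf_mul_fun /=.
  have [id|id] := eqVneq (l i).1 (m d).1; last first.
    apply: fsbig1 => c _; rewrite z'E /relabel /S.
    case: ifP => [/andP[_ /eqP ic]|_]; last by rewrite rmul0l.
    by rewrite -ic (negbTE id) rmul0r.
  rewrite -(@sum_label m (l i).1 (fun k => pick (l i).1 s1 s2 (l i).2 k **
    pick (l i).1 x' y' k (m d).2))// => [|k]; last first.
    move=> sx; apply: (cover _ k (m d).2); left.
    by apply: contraNneq sx => ->; rewrite rmul0r.
  apply: eq_fsbigr => c _; rewrite /S iK /=.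
  have [ic|ic] := eqVneq (l i).1 (m c).1; last by rewrite andbF rmul0l.
  rewrite andbT; case: ltnP => cK.
    by rewrite z'E /relabel -ic -id eqxx.
  rewrite rmul0l; apply/esym.
  have := z'E c d; rewrite (corner0 z'K) ?cK// /relabel -ic -id eqxx => <-.
  by rewrite rmul0r.
apply: Minf_ext => i j.
have [iK|Ki] := ltnP i K; last first.
  rewrite (corner0 zK) ?Ki// (@Minf_mulE K); last by right.
  rewrite big1// => k _; rewrite (@Minf_mulE K); last by left.
  rewrite big1 ?rmul0l// => k' _.
  by rewrite [X in X ** _](corner0 SK) ?Ki// rmul0l.
have [jK|Kj] := ltnP j K; last first.
  rewrite (corner0 zK) ?Kj ?orbT// (@Minf_mulE K); last by right.
  by rewrite big1// => k _; rewrite [X in _ ** X](corner0 TK) ?Kj ?orbT// rmul0r.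
transitivity (\sum_(d \in [set: nat])
  Minf_mul (MkMinf (corner_finite SK)) z' i d ** T d j); last by [].
rewrite zE /relabel.
have [ij|ij] := eqVneq (l i).1 (l j).1; last first.
  apply/esym/fsbig1 => d _; rewrite SzE//.
  have [id|id] := eqVneq (l i).1 (m d).1; last by rewrite rmul0l.
  by rewrite /= /T -id (negbTE ij) andbF rmul0r.
have -> : pick (l i).1 x y = Minf_mul (Minf_mul (pick (l i).1 s1 s2)
    (pick (l i).1 x' y')) (pick (l i).1 t1 t2) by case: (l i).1.
rewrite [LHS]/= [LHS]/Minf_mul_fun -(@sum_label m (l i).1 (fun k =>
  Minf_mul (pick (l i).1 s1 s2) (pick (l i).1 x' y') (l i).2 k **
  pick (l i).1 t1 t2 k (l j).2))// => [|k]; last first.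
  apply: contraPP => nc; apply/negP; rewrite negbK.
  rewrite /= /Minf_mul_fun fsbig1 ?rmul0l// => k' _.
  have [->|x'k] := eqVneq (pick (l i).1 x' y' k' k) 0; first by rewrite rmul0r.
  by case: nc; apply: (cover _ k k'); right.
apply: eq_fsbigr => d _; rewrite SzE//.
have [id|id] := eqVneq (l i).1 (m d).1; last by rewrite rmul0l.
have [dK|Kd] := ltnP d K; first by rewrite /T dK jK -id ij eqxx.
rewrite [X in _ = _ ** X](corner0 TK) ?Kd// rmul0r.
suff -> : Minf_mul (pick (l i).1 s1 s2) (pick (l i).1 x' y') (l i).2 (m d).2 = 0.
  by rewrite rmul0l.
have := SzE i d iK; rewrite -id eqxx => <-.
rewrite /= /Minf_mul_fun fsbig1// => c _.
by rewrite (corner0 z'K) ?Kd ?orbT// rmul0r.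
Qed.

Lemma lesim1_block N N' x x' y y' : corner N x -> corner N' x' ->
  lesim1 x x' -> lesim1 y y' -> lesim1 (block N x y) (block N' x' y').
Proof.
move=> xN x'N; pose l P i := if (i < P)%N then (false, i) else (true, i - P)%N.
have blE P a b i j : block P a b i j = relabel (l P) a b i j.
  by rewrite /relabel /l /= /block_fun; case: (ltnP i) => _; case: (ltnP j) => _.
apply: (@lesim1_relabel (l N) (l N')) => [i j|k j x'k|k j _|i j|i j] //.
- rewrite /l; case: ltnP => iN; case: ltnP => jN [] // ij.
  by rewrite -(subnK iN) ij subnK.
- by exists k; rewrite /l; case: x'k => /x'N[kN jN]; rewrite ?kN ?jN.
- by exists (k + N')%N; rewrite /l ltnNge leq_addl addnK.
Qed.

Lemma lesim1_block_swap N M x x' y y' : corner N x -> corner M y' ->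
  lesim1 x x' -> lesim1 y y' -> lesim1 (block N x y) (block M y' x').
Proof.
move=> xN y'M; pose l P i := if (i < P)%N then (false, i) else (true, i - P)%N.
pose m P i := if (i < P)%N then (true, i) else (false, i - P)%N.
apply: (@lesim1_relabel (l N) (m M)) => [i j|k j _|k j y'k|i j|i j] //.
- rewrite /m; case: ltnP => iN; case: ltnP => jN [] // ij.
  by rewrite -(subnK iN) ij subnK.
- by exists (k + M)%N; rewrite /m ltnNge leq_addl addnK.
- by exists k; rewrite /m; case: y'k => /y'M[kN jN]; rewrite ?kN ?jN.
- by rewrite /relabel /l /= /block_fun; case: (ltnP i) => _; case: (ltnP j) => _.
- by rewrite /relabel /m /= /block_fun; case: (ltnP i) => _; case: (ltnP j) => _.
Qed.

Lemma blockA N M x y z :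
  block (N + M) (block N x y) z = block N x (block M y z).
Proof.
apply: Minf_ext => i j; rewrite /= /block_fun /= /block_fun.
have E k : (N <= k)%N -> (k < N + M)%N = (k - N < M)%N.
  by move=> Nk; rewrite ltn_subLR.
have [iN|Ni] := ltnP i N; have [jN|Nj] := ltnP j N => /=.
- by rewrite !(ltn_addr M).
- by rewrite (ltn_addr M iN) /= [(N + M <= i)%N]leqNgt (ltn_addr M iN); case: ifP.
- by rewrite (ltn_addr M jN) andbT [(N + M <= j)%N]leqNgt (ltn_addr M jN) andbF; case: ifP.
- by rewrite ![(N + M <= _)%N]leqNgt !E// -!leqNgt !subnDA.
Qed.

Lemma block0 N x : corner N x -> block N x Minf0 = x.
Proof.
move=> xN; apply: Minf_ext => i j; rewrite /= /block_fun.
case: ifP => // /negbT; rewrite negb_and -!leqNgt => ij.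
by rewrite (corner0 xN ij) if_same.
Qed.

Lemma corner_block N M x y : corner M y -> corner (N + M) (block N x y).
Proof.
move=> yM i j; rewrite /= /block_fun.
case: ifP => [/andP[iN jN] _|_]; first by rewrite !ltn_addr.
case: ifP => [/andP[iN jN] /yM|]; last by rewrite eqxx.
by rewrite !ltn_subLR.
Qed.

End Minf.

Arguments oplus_corner {R} x _ _ _.

Section Minf_map.
Variables (R R' : rngType) (f : rng_hom R R').

Lemma Minf_map_corner N (x : Minf R) :
  corner N x -> corner N (fun i j => f (x i j)).
Proof. by move=> xN i j fx; apply: xN; apply: contraNneq fx => ->; rewrite rng_hom0. Qed.

Lemma Minf_map_finite (x : Minf R) :
  finite_set [set ij : nat * nat | f (x ij.1 ij.2) != 0].
Proof.
by have [N xN] := corner_ex x; exact: corner_finite (Minf_map_corner xN).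
Qed.

Definition Minf_map (x : Minf R) : Minf R' :=
  @MkMinf R' (fun i j => f (x i j)) (Minf_map_finite x).

Lemma Minf_mapM (x y : Minf R) :
  Minf_map (Minf_mul x y) = Minf_mul (Minf_map x) (Minf_map y).
Proof.
apply: Minf_ext => i j; have [N xN] := corner_ex x.
rewrite (@Minf_mulE _ N); last by left; exact: Minf_map_corner.
rewrite [LHS](congr1 f (@Minf_mulE _ N x y i j (or_introl xN))).
by rewrite rng_hom_sum; apply: eq_bigr => k _; rewrite rng_homM.
Qed.

Lemma Minf_map_lesim1 (x y : Minf R) :
  lesim1 x y -> lesim1 (Minf_map x) (Minf_map y).
Proof.
by move=> [s [t ->]]; exists (Minf_map s), (Minf_map t); rewrite !Minf_mapM.
Qed.

End Minf_map.

(* Sequences are indexed from 0 instead of 1. *)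
Record Tseq (R : rngType) := MkTseq {
  term :> nat -> Minf R;
  termP : forall n, lesim1 (term n) (term n.+1)
}.

HB.instance Definition _ (R : rngType) := gen_eqMixin (Tseq R).
HB.instance Definition _ (R : rngType) := gen_choiceMixin (Tseq R).

Definition calS (R : rngType) : set (Tseq R) :=
  [set x | forall n, exists y, x n = Minf_mul (Minf_mul y (x n.+1)) (x n)].

Definition Tmap (R R' : rngType) (f : rng_hom R R') (x : Tseq R) : Tseq R' :=
  MkTseq (fun n => Minf_map_lesim1 f (termP x n)).

Section Lambda.
Variable R : rngType.
Implicit Types x y z : Tseq R.

Definition lesim x y := forall n, exists m, lesim1 (x n) (y m).

Lemma lesim_refl x : lesim x x.
Proof. by move=> n; exists n.+1; exact: termP. Qed.

Lemma lesim_trans y x z : lesim x y -> lesim y z -> lesim x z.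
Proof.
move=> xy yz n; have [m nm] := xy n; have [k mk] := yz m.
by exists k; exact: lesim1_trans nm mk.
Qed.

Lemma lesim_leq x y n m k : (m <= k)%N -> lesim1 (x n) (y m) ->
  lesim1 (x n) (y k).
Proof.
move=> /subnK <-; elim: (k - m)%N => [//|p IH] /IH xp.
exact: lesim1_trans xp (termP _ _).
Qed.

Definition eqsim x y : bool := `[< lesim x y /\ lesim y x >].

Lemma eqsim_refl : reflexive eqsim.
Proof. by move=> x; apply/asboolP; split; exact: lesim_refl. Qed.

Lemma eqsim_sym : symmetric eqsim.
Proof. by move=> x y; apply/asbool_equiv_eq; split=> -[]. Qed.

Lemma eqsim_trans : transitive eqsim.
Proof.
move=> y x z /asboolP[xy yx] /asboolP[yz zy]; apply/asboolP.
by split; [exact: lesim_trans xy yz | exact: lesim_trans zy yx].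
Qed.

Canonical eqsim_canonical := EquivRel eqsim eqsim_refl eqsim_sym eqsim_trans.

Definition Lambda : Type := {eq_quot eqsim}.
HB.instance Definition _ := Choice.on Lambda.
HB.instance Definition _ := EqQuotient.on Lambda.

Lemma Lambda_eqP x y :
  \pi_Lambda x = \pi_Lambda y <-> lesim x y /\ lesim y x.
Proof. by split=> [/eqmodP/asboolP//|xy]; apply/eqmodP/asboolP. Qed.

Lemma lesim_repr x :
  lesim x (repr (\pi_Lambda x)) /\ lesim (repr (\pi_Lambda x)) x.
Proof. by apply/Lambda_eqP; rewrite reprK. Qed.

(* [Lambda_le], [Lambda_add] and [Lambda_prec] are defined on chosen
   representatives; [Lambda_leE], [pi_block] and [Lambda_precE] show that they do
   not depend on the choice. *)
Definition Lambda_le (a b : Lambda) : bool := `[< lesim (repr a) (repr b) >].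

Lemma Lambda_le_refl : reflexive Lambda_le.
Proof. by move=> a; apply/asboolP; exact: lesim_refl. Qed.

Lemma Lambda_le_anti : antisymmetric Lambda_le.
Proof.
move=> a b /andP[/asboolP ab /asboolP ba].
by rewrite -[a]reprK -[b]reprK; apply/Lambda_eqP.
Qed.

Lemma Lambda_le_trans : transitive Lambda_le.
Proof.
by move=> b a c /asboolP ab /asboolP bc; apply/asboolP; exact: lesim_trans ab bc.
Qed.

HB.instance Definition _ := Order.Le_isPOrder.Build ring_display Lambda
  Lambda_le_refl Lambda_le_anti Lambda_le_trans.

Lemma Lambda_leE x y : (\pi_Lambda x <= \pi_Lambda y) <-> lesim x y.
Proof.
have [[x1 x2] [y1 y2]] := (lesim_repr x, lesim_repr y).
split=> [/asboolP xy|xy]; last apply/asboolP.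
  exact: lesim_trans x1 (lesim_trans xy y2).
exact: lesim_trans x2 (lesim_trans xy y1).
Qed.

Lemma Tsum_subproof x y n : lesim1 (oplus (x n) (y n)) (oplus (x n.+1) (y n.+1)).
Proof. by apply: lesim1_block; [exact: oplus_corner.. | exact: termP | exact: termP]. Qed.

Definition Tsum x y : Tseq R := MkTseq (Tsum_subproof x y).

Definition Tzero : Tseq R := @MkTseq R (fun _ => Minf0 R) (fun _ => lesim1_0 _).

Definition Lambda_zero : Lambda := \pi_Lambda Tzero.

Definition Lambda_add (a b : Lambda) : Lambda := \pi_Lambda (Tsum (repr a) (repr b)).

Lemma lesim_block x x' y y' z z' (N N' : nat -> nat) :
  (forall n, corner (N n) (x n)) -> (forall n, corner (N' n) (x' n)) ->
  (forall n, z n = block (N n) (x n) (y n)) ->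
  (forall n, z' n = block (N' n) (x' n) (y' n)) ->
  lesim x x' -> lesim y y' -> lesim z z'.
Proof.
move=> xN x'N zE z'E xx' yy' n; have [[m xm] [k yk]] := (xx' n, yy' n).
exists (maxn m k); rewrite zE z'E; apply: lesim1_block => //.
  exact: lesim_leq (leq_maxl _ _) xm.
exact: lesim_leq (leq_maxr _ _) yk.
Qed.

Lemma pi_block x y z (N : nat -> nat) : (forall n, corner (N n) (x n)) ->
  (forall n, z n = block (N n) (x n) (y n)) ->
  Lambda_add (\pi_Lambda x) (\pi_Lambda y) = \pi_Lambda z.
Proof.
move=> xN zE; have [[x1 x2] [y1 y2]] := (lesim_repr x, lesim_repr y).
have rN n := oplus_corner (repr (\pi_Lambda x) n).
apply/Lambda_eqP; split; first exact: (lesim_block rN xN _ zE).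
exact: (lesim_block xN rN zE).
Qed.

Lemma Lambda_addA : associative Lambda_add.
Proof.
move=> a b c; rewrite -[a]reprK -[b]reprK -[c]reprK.
move: (repr a) (repr b) (repr c) => x y z.
have xN n := oplus_corner (x n); have yN n := oplus_corner (y n).
have sE u v n : Tsum u v n = oplus (u n) (v n) by [].
rewrite (pi_block yN (sE y z)) (pi_block xN (sE x (Tsum y z))).
rewrite (pi_block xN (sE x y)); apply/esym.
apply: (pi_block (N := fun n => (_ + _)%N)) => n.
  by rewrite sE; apply: corner_block; exact: yN.
by rewrite !sE /oplus blockA.
Qed.

Lemma Lambda_addC : commutative Lambda_add.
Proof.
suff le a b : Lambda_add a b <= Lambda_add b a.
  by move=> a b; apply/le_anti; rewrite !le.
apply/Lambda_leE => n; exists n.+1; apply: lesim1_block_swap;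
  by [exact: oplus_corner | exact: termP].
Qed.

Lemma Lambda_add0 : left_id Lambda_zero Lambda_add.
Proof.
move=> a; rewrite Lambda_addC -[a]reprK; have xN n := oplus_corner (repr a n).
by apply: (pi_block xN) => n; rewrite block0.
Qed.

HB.instance Definition _ := Monoid.isComLaw.Build Lambda Lambda_zero Lambda_add
  Lambda_addA Lambda_addC Lambda_add0.

Lemma Lambda_ge0 (a : Lambda) : Lambda_zero <= a.
Proof.
rewrite -[a]reprK; apply/Lambda_leE => n; exists 0%N; exact: lesim1_0.
Qed.

Lemma Lambda_leD2r (c a b : Lambda) : a <= b -> Lambda_add a c <= Lambda_add b c.
Proof.
move=> /asboolP ab; apply/Lambda_leE.
apply: (@lesim_block (repr a) (repr b) (repr c) (repr c) _ _
  (fun n => xget 0%N [set N | corner N (repr a n)])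
  (fun n => xget 0%N [set N | corner N (repr b n)])) => // [n|n|].
- exact: oplus_corner.
- exact: oplus_corner.
- exact: lesim_refl.
Qed.

Definition Lambda_prec (a b : Lambda) : Prop :=
  exists m, forall n, lesim1 (repr a n) (repr b m).

Lemma Lambda_precE x y : Lambda_prec (\pi_Lambda x) (\pi_Lambda y) <->
  exists m, forall n, lesim1 (x n) (y m).
Proof.
have [[x1 x2] [y1 y2]] := (lesim_repr x, lesim_repr y).
have tr u u' v v' : lesim u' u -> lesim v v' ->
    (exists m, forall n, lesim1 (u n) (v m)) ->
    exists m, forall n, lesim1 (u' n) (v' m).
  move=> uu vv [m uv]; have [k mk] := vv m; exists k => n.
  have [p np] := uu n.
  exact: lesim1_trans np (lesim1_trans (uv p) mk).
by split; exact: tr.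
Qed.

Definition S_ : set Lambda := \pi_Lambda @` @calS R.

End Lambda.

(* An HB structure joining [porderType] and [nmodType] cannot be declared
   downstream of [porderZmodType]; hence this unbundled commutative monoid. *)
Record pomType := MkPOM {
  pom_sort :> porderType ring_display;
  pom_zero : pom_sort;
  pom_add : Monoid.com_law pom_zero;
  pom_ge0 : forall x, pom_zero <= x;
  pom_leD2r : forall z x y, x <= y -> pom_add x z <= pom_add y z
}.
Arguments pom_zero {p}.
Arguments pom_add {p}.

Declare Scope pom_scope.
Delimit Scope pom_scope with P.
Notation "0" := pom_zero : pom_scope.
Notation "x + y" := (pom_add x y) : pom_scope.
Local Open Scope pom_scope.

Definition Lambda_pom (R : rngType) : pomType :=
  @MkPOM (Lambda R) (Lambda_zero R) (@Lambda_add R)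
    (@Lambda_ge0 R) (@Lambda_leD2r R).

Definition nondecreasing (S : pomType) (u : nat -> S) :=
  {homo u : n m / (n <= m)%N >-> n <= m}.

Record is_additive_auxiliary (S : pomType) (prec : S -> S -> Prop) : Prop := {
  aux_le : forall x y, prec x y -> x <= y;
  aux_trans : forall x' x y y', x' <= x -> prec x y -> y <= y' -> prec x' y';
  aux_0 : forall x, prec 0 x;
  aux_add : forall x1 y1 x2 y2,
    prec x1 y1 -> prec x2 y2 -> prec (x1 + x2) (y1 + y2)
}.

Record is_Qsemigroup (S : pomType) (prec : S -> S -> Prop) : Prop := {
  Q_aux : is_additive_auxiliary prec;
  Q_O1 : forall u : nat -> S, nondecreasing u ->
    exists s, supremums (range u) s;
  Q_O4 : forall (u v : nat -> S) (s t : S), nondecreasing u -> nondecreasing v ->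
    supremums (range u) s -> supremums (range v) t ->
    supremums (range (fun n => u n + v n)) (s + t)
}.

(* [s] is the supremum of [y], which exists in a Q-semigroup. *)
Definition weakly_increasing (S : pomType) (x : nat -> S) : Prop :=
  exists (y : nat -> S) (s : S), [/\ nondecreasing y, supremums (range y) s,
    forall m, exists k, forall n, (k <= n)%N -> y m <= x n
    & forall n, x n <= s].

Record is_SQ_object (S : pomType) (prec : S -> S -> Prop) (W : set S) : Prop := {
  SQ_Q : is_Qsemigroup prec;
  SQ_W0 : W 0;
  SQ_WD : forall a b, W a -> W b -> W (a + b);
  SQ_Wsup : forall (x : nat -> S) (s : S), (forall n, W (x n)) ->
    weakly_increasing x -> supremums (range x) s -> W s
}.

Record SQ_object := MkSQ {
  SQ_carrier :> pomType;
  SQ_prec : SQ_carrier -> SQ_carrier -> Prop;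
  SQ_sub : set SQ_carrier;
  SQ_objectP : is_SQ_object SQ_prec SQ_sub
}.

Record is_SQ_morphism (A B : SQ_object) (f : A -> B) : Prop := {
  SQ_mor_0 : f 0 = 0;
  SQ_mor_add : {morph f : x y / x + y};
  SQ_mor_prec : forall x y, SQ_prec x y -> SQ_prec (f x) (f y);
  SQ_mor_sup : forall (u : nat -> A) (s : A), nondecreasing u ->
    supremums (range u) s -> supremums (range (f \o u)) (f s);
  SQ_mor_sub : f @` @SQ_sub A `<=` @SQ_sub B
}.

Record SQ_hom (A B : SQ_object) := MkSQHom {
  SQ_fun :> A -> B;
  SQ_homP : is_SQ_morphism SQ_fun
}.

Lemma SQ_hom_ext (A B : SQ_object) (f g : SQ_hom A B) : f =1 g -> f = g.
Proof.
case: f g => f fP [g gP] /= /funext fg; case: g / fg in gP *.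
by rewrite (Prop_irrelevance fP gP).
Qed.

Lemma SQ_mor_homo (A B : SQ_object) (f : A -> B) : is_SQ_morphism f ->
  {homo f : x y / x <= y}.
Proof.
move=> fP x y xy; pose u n := if n is 0%N then x else y.
have [] := SQ_mor_sup fP (u := u) (s := y).
- by move=> [|n] [|m].
- by split=> [_ [[|n] _ <-] //=|z uz]; apply: uz; exists 1%N.
- by move=> fu _; apply: fu; exists 0%N.
Qed.

Lemma SQ_idP (A : SQ_object) : is_SQ_morphism (@id A).
Proof. by split=> //; rewrite image_id. Qed.

Definition SQ_id (A : SQ_object) : SQ_hom A A := MkSQHom (SQ_idP A).

Lemma SQ_compP (A B C : SQ_object) (g : SQ_hom B C) (f : SQ_hom A B) :
  is_SQ_morphism (g \o f).
Proof.
case: f g => f fP [g gP]; split.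
- by rewrite /= (SQ_mor_0 fP) (SQ_mor_0 gP).
- by move=> x y /=; rewrite (SQ_mor_add fP) (SQ_mor_add gP).
- by move=> x y /(SQ_mor_prec fP)/(SQ_mor_prec gP).
- move=> u s ui us; apply: (SQ_mor_sup gP); last exact: SQ_mor_sup.
  by move=> n m nm; exact/(SQ_mor_homo fP)/ui.
- move=> _ [x Ax <-] /=; apply: (SQ_mor_sub gP); exists (f x) => //.
  by apply: (SQ_mor_sub fP); exists x.
Qed.

Definition SQ_comp (A B C : SQ_object) (g : SQ_hom B C) (f : SQ_hom A B) :
  SQ_hom A C := MkSQHom (SQ_compP g f).

Definition SQ : category.
Proof.
refine (@Category SQ_object SQ_hom SQ_id SQ_comp _ _ _);
  by move=> *; exact: SQ_hom_ext.
Defined.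

(* Main.v *)
Require Import Defs.
From mathcomp Require Import all_boot all_order ssralg orderedzmod generic_quotient.
From mathcomp Require Import boolp classical_sets cardinality fsbigop.

Set Implicit Arguments.
Unset Strict Implicit.
Unset Printing Implicit Defensive.

Import Order.TTheory.

Local Open Scope quotient_scope.

(** The order and the sums of [Lambda R] are read off single terms of sequences:
    the supremum of the classes of sequences [X n] is the class of any sequence
    [z] all of whose terms lie below terms of the [X n], and conversely
    ([is_join]). Such a [z] exists for an increasing family, because its
    countably many terms are directed for [lesim1], and a countable directed
    family has a cofinal chain ([directed_chain], [is_join_exists]). By
    uniqueness of suprema, every supremum of an increasing sequence is a join
    ([supremums_is_join]). This termwise description gives (O1) and (O4), and
    shows that entrywise application of a ring homomorphism preserves suprema,
    since it preserves [lesim1].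

    Two points concern [S_ R]. The condition [x_n = y x_(n+1) x_n] is not
    invariant under the equivalence that makes the size of the corner irrelevant
    in [x (+) y]: it multiplies consecutive terms, and two block diagonal
    matrices multiply blockwise only when their corners have the same size. So
    the sum of two classes in [S_ R] is represented instead by interleaving, with
    [x] on the even indices and [y] on the odd ones. Interleaving is
    multiplicative, which makes the condition immediate, and it differs from the
    block sum only by a relabelling of the indices.

    For suprema ([calS_is_join]), let [e_0, e_1, ...] be a cofinal chain of terms
    of sequences in [calS], [e'_n] the successor of [e_n] in its own sequence, so
    that [e_n = c_n e'_n e_n], and let the chain be so sparse that
    [e'_n = s_n e_(n+1) t_n]. The terms [e_n] need not satisfy the condition, but
    absorbing [t_n] on the right does not disturb [e_(n+1) = c e' e_(n+1)]: the
    matrices [w_n = e_(n+1) t_n] satisfy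
    [w_n = c_(n+1) e'_(n+1) w_n = c_(n+1) s_(n+1) w_(n+1) w_n]. *)

(** * Cofinal chains *)

(** The chain is built by recursion: its [n]-th step dominates both the preceding
    term and the [n]-th element of [I]. Over a ring without unit [lesim1] is not
    reflexive, so an element may fail to dominate itself, and directedness is used even when
    the two elements agree. *)
Lemma directed_chain (I : countType) (i0 : I) (r : I -> I -> Prop) :
  (forall a b, exists c, r a c /\ r b c) ->
  exists f : nat -> I,
    (forall n, r (f n) (f n.+1)) /\ forall a, exists n, r a (f n).
Proof.
move=> dir.
have /choice[h hP] : forall ab : I * I, exists c, r ab.1 c /\ r ab.2 c.
  by move=> [a b]; exact: dir.
pose f := fix f n := if n is m.+1 then h (f m, odflt i0 (unpickle m)) else i0.
exists f; split=> [n|a]; first by have [] := hP (f n, odflt i0 (unpickle n)).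
exists (pickle a).+1.
by have [_] := hP (f (pickle a), odflt i0 (unpickle (pickle a))); rewrite /= pickleK.
Qed.

(** * Interleaving two matrices *)

Section Interleave.
Variable R : rngType.
Local Open Scope classical_set_scope.
Local Open Scope ring_scope.
Implicit Types x y z : Minf R.

Let halves (i : nat) := (odd i, i./2).

Let halves_inj : injective halves.
Proof. by move=> i j [oij hij]; rewrite -(odd_double_half i) oij hij odd_double_half. Qed.

Let halves_surj b k : exists c, halves c = (b, k).
Proof.
exists (b + k.*2)%N; rewrite /halves oddD odd_double addbF half_bit_double.
by case: b.
Qed.

Definition interleave_fun x y i j : R :=
  if odd i == odd j then (if odd i then y else x) i./2 j./2 else 0.

Lemma interleave_finite x y :
  finite_set [set ij : nat * nat | interleave_fun x y ij.1 ij.2 != 0].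
Proof.
have [N xN yN] := corner_ex2 x y.
apply: (@corner_finite _ (N.*2)) => i j; rewrite /interleave_fun.
case: ifP => _; last by rewrite eqxx.
suff: (i./2 < N)%N /\ (j./2 < N)%N -> (i < N.*2)%N /\ (j < N.*2)%N.
  by case: ifP => _ H /=; [move/yN | move/xN].
by rewrite !ltn_half_double.
Qed.

Definition interleave x y : Minf R := MkMinf (interleave_finite x y).

(** In the sum defining an entry, only the middle indices with the parity of the
    two outer ones contribute, and halving enumerates them without repetition. *)
Lemma interleaveM x y x' y' :
  Minf_mul (interleave x y) (interleave x' y') =
  interleave (Minf_mul x x') (Minf_mul y y').
Proof.
apply: Minf_ext => i j; rewrite /= {1}/Minf_mul_fun /interleave_fun /=.
rewrite /interleave_fun.
have [ij|ij] := eqVneq (odd i) (odd j); last first.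
  apply: fsbig1 => c _.
  have [ic|_] := eqVneq (odd i) (odd c); last by rewrite rmul0l.
  by rewrite -ic (negbTE ij) rmul0r.
transitivity (\sum_(k \in [set: nat]) (if odd i then y else x) i./2 k **
    (if odd i then y' else x') k j./2); last by case: (odd i).
rewrite -(@sum_label R halves (odd i) _ halves_inj) => [|k _]; last first.
  exact: halves_surj.
apply: eq_fsbigr => c _ /=.
have [ic|_] := eqVneq (odd i) (odd c); last by rewrite rmul0l.
by rewrite -ic ij eqxx.
Qed.

Lemma interleave_lesim1 x x' y y' : lesim1 x x' -> lesim1 y y' ->
  lesim1 (interleave x y) (interleave x' y').
Proof.
move=> [s [t ->]] [s' [t' ->]]; exists (interleave s s'), (interleave t t').
by rewrite !interleaveM.
Qed.

(* The labelling of indices that underlies [block N], as [halves] underlies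
   [interleave]. *)
Let side N (i : nat) := if (i < N)%N then (false, i) else (true, i - N)%N.

Let blockE N x y i j : block N x y i j =
  if (side N i).1 == (side N j).1 then
    (if (side N i).1 then y else x) (side N i).2 (side N j).2 else 0.
Proof.
by rewrite /side /= /block_fun; case: (ltnP i) => _; case: (ltnP j) => _.
Qed.

Lemma lesim1_block_interleave N x x' y y' : lesim1 x x' -> lesim1 y y' ->
  lesim1 (block N x y) (interleave x' y').
Proof.
exact: (lesim1_relabel halves_inj (fun k _ _ => halves_surj false k)
  (fun k _ _ => halves_surj true k) (blockE N x y)).
Qed.

Lemma lesim1_interleave_block N x x' y y' : corner N x' ->
  lesim1 x x' -> lesim1 y y' -> lesim1 (interleave x y) (block N x' y').
Proof.
move=> x'N; apply: (@lesim1_relabel R halves (side N)) => //.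
- move=> i j; rewrite /side; case: ltnP => iN; case: ltnP => jN [] // ij.
  by rewrite -(subnK iN) ij subnK.
- by move=> k j x'k; exists k; rewrite /side; case: x'k => /x'N[kN jN]; rewrite ?kN ?jN.
- by move=> k j _; exists (k + N)%N; rewrite /side ltnNge leq_addl addnK.
Qed.

End Interleave.

(** * Suprema, term by term *)

Section Joins.
Variable R : rngType.
Local Open Scope classical_set_scope.
Local Open Scope ring_scope.
Implicit Types (x y z : Tseq R) (X : nat -> Tseq R) (a b : Lambda R).

Definition is_join X z := (forall n, lesim (X n) z) /\
  forall p, exists n q, lesim1 (z p) (X n q).

Lemma eq_pi x y : (forall n, x n = y n) -> \pi_(Lambda R) x = \pi_(Lambda R) y.
Proof.
by move=> xy; apply/Lambda_eqP; split=> n; exists n.+1; rewrite ?xy -?xy; exact: termP.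
Qed.

Lemma is_join_lesim X z w : is_join X z -> (forall n, lesim (X n) w) -> lesim z w.
Proof.
move=> [_ zX] Xw p; have [n [q zq]] := zX p; have [m qm] := Xw n q.
by exists m; exact: lesim1_trans zq qm.
Qed.

Lemma is_join_supremums X z : is_join X z ->
  supremums (range (fun n => \pi_(Lambda R) (X n))) (\pi_(Lambda R) z).
Proof.
move=> Xz; split=> [_ [n _ <-]|w wX]; first exact/Lambda_leE/(Xz.1 n).
rewrite -[w]reprK; apply/Lambda_leE/(is_join_lesim Xz) => n.
by apply/Lambda_leE; rewrite reprK; apply: wX; exists n.
Qed.

(** The terms [X n q] are directed: two of them lie below terms of a common,
    later sequence, hence below a common term. A cofinal chain of them is the
    join. *)
Lemma is_join_exists X : (forall n m, (n <= m)%N -> lesim (X n) (X m)) ->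
  exists z, is_join X z.
Proof.
move=> Xle.
have [|f [fS fX]] := @directed_chain (nat * nat)%type (0%N, 0%N)
    (fun i j => lesim1 (X i.1 i.2) (X j.1 j.2)).
  move=> [n q] [m p].
  have [u qu] := Xle n (maxn n m) (leq_maxl _ _) q.
  have [v pv] := Xle m (maxn n m) (leq_maxr _ _) p.
  exists (maxn n m, maxn u v); split.
  - exact: lesim_leq (leq_maxl _ _) qu.
  - exact: lesim_leq (leq_maxr _ _) pv.
exists (MkTseq fS); split=> [n q|p].
- by have [k qk] := fX (n, q); exists k.
- by exists (f p.+1).1, (f p.+1).2; exact: fS.
Qed.

(** Each term of a supremum lies below a term of some [u n]. The abstract least
    upper bound gives no hold on terms, but it is equivalent to the join built in
    [is_join_exists]. *)
Lemma supremums_is_join (u : nat -> Lambda_pom R) (s : Lambda_pom R) :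
  nondecreasing u -> supremums (range u) s -> is_join (fun n => repr (u n)) (repr s).
Proof.
move=> u_le [su s_least].
have leP (a b : Lambda R) : a <= b -> lesim (repr a) (repr b).
  by move=> ab; apply/Lambda_leE; rewrite !reprK.
split=> [n|p]; first by apply: leP; apply: su; exists n.
have [z uz] := @is_join_exists (fun n => repr (u n)) (fun n m nm => leP _ _ (u_le n m nm)).
have [zu _] := is_join_supremums uz.
have /(_ p)[m pm] : lesim (repr s) z.
  apply/Lambda_leE; rewrite reprK; apply: s_least => _ [n _ <-].
  by apply: zu; exists n => //; rewrite reprK.
have [n [q mq]] := uz.2 m.
by exists n, q; exact: lesim1_trans pm mq.
Qed.

(** A cofinal chain of terms of the [X n] is corrected by the right factors that
    relate its consecutive terms. The relation that the chain follows leaves room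
    for one step inside [X n]: the successor of each chosen term lies below the
    next chosen term. *)
Lemma calS_is_join X z : (forall n, calS (X n)) -> is_join X z ->
  exists2 w, calS w & lesim w z /\ lesim z w.
Proof.
move=> XS [Xz zX].
have [|f [fS fX]] := @directed_chain (nat * nat)%type (0%N, 0%N)
    (fun i j => lesim1 (X i.1 i.2.+1) (X j.1 j.2)).
  move=> [n q] [m p] /=.
  have [u qu] := Xz n q.+1; have [v pv] := Xz m p.+1.
  have [k [r zr]] := zX (maxn u v); exists (k, r); split.
  - exact: lesim1_trans (lesim_leq (leq_maxl _ _) qu) zr.
  - exact: lesim1_trans (lesim_leq (leq_maxr _ _) pv) zr.
pose e n := X (f n).1 (f n).2; pose e' n := X (f n).1 (f n).2.+1.
have /choice[c cE] : forall n, exists c, e n = Minf_mul (Minf_mul c (e' n)) (e n).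
  by move=> n; exact: XS.
have [s sE] := choice fS; have [t tE] := choice sE.
(* The shift by one is what makes [w n] start with a term that satisfies
   [e = c e' e] and end with the factor [t n] that [e' n] needs. *)
pose w n := Minf_mul (e n.+1) (t n).
have e'w n : e' n = Minf_mul (s n) (w n) by rewrite /w Minf_mulA -tE.
have wE n : w n = Minf_mul (Minf_mul (c n.+1) (e' n.+1)) (w n).
  by rewrite {1}/w {1}cE -Minf_mulA.
have ewS n : e n = Minf_mul (Minf_mul (Minf_mul (c n) (s n)) (w n)) (e n).
  by rewrite {1}cE e'w !Minf_mulA.
have wS n : w n = Minf_mul (Minf_mul (Minf_mul (c n.+1) (s n.+1)) (w n.+1)) (w n).
  by rewrite {1}wE e'w !Minf_mulA.
have wT n : lesim1 (w n) (w n.+1).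
  by exists (Minf_mul (c n.+1) (s n.+1)), (w n).
exists (MkTseq wT); first by move=> n; exists (Minf_mul (c n.+1) (s n.+1)).
split=> [n|p].
- have [m em] := Xz (f n.+1).1 (f n.+1).2.+1; exists m; apply: lesim1_trans em.
  by exists (c n.+1), (w n).
- have [n [q pq]] := zX p; have [k qk] := fX (n, q); exists k.
  apply: lesim1_trans pq (lesim1_trans (termP (X n) q) (lesim1_trans qk _)).
  by exists (Minf_mul (c k) (s k)), (e k); exact: ewS.
Qed.

(** * The pair of Lambda and S *)

(** The interleaving of the two sequences replaces their block sum, whose corners
    vary with [n]. *)
Lemma S_add_pi x y : calS x -> calS y ->
  S_ (Lambda_add (\pi_(Lambda R) x) (\pi_(Lambda R) y)).
Proof.
move=> xS yS.
have wT n : lesim1 (interleave (x n) (y n)) (interleave (x n.+1) (y n.+1)).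
  by apply: interleave_lesim1; exact: termP.
exists (MkTseq wT).
  move=> n; have [[c cE] [d dE]] := (xS n, yS n).
  by exists (interleave c d); rewrite /= !interleaveM -cE -dE.
rewrite (@pi_block _ x y (Tsum x y) _ (fun n => oplus_corner (x n))) //.
apply/Lambda_eqP; split=> n; exists n.+1.
- apply: lesim1_interleave_block; [exact: oplus_corner | exact: termP | exact: termP].
- by apply: lesim1_block_interleave; exact: termP.
Qed.

Lemma Lambda_add_le a b a' b' : a <= a' -> b <= b' ->
  Lambda_add a b <= Lambda_add a' b'.
Proof.
move=> aa' bb'; apply: le_trans (Lambda_leD2r b aa') _.
by rewrite ![Lambda_add a' _]Lambda_addC; exact: Lambda_leD2r.
Qed.

Lemma Lambda_prec_additive_auxiliary :
  is_additive_auxiliary (S := Lambda_pom R) (@Lambda_prec R).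
Proof.
split.
- by move=> a b [m ab]; apply/asboolP => n; exists m.
- move=> a' a b b' /asboolP a'a [m ab] /asboolP bb'.
  have [k mk] := bb' m; exists k => n; have [p np] := a'a n.
  exact: lesim1_trans np (lesim1_trans (ab p) mk).
- move=> a; rewrite -[a]reprK; apply/Lambda_precE.
  by exists 0%N => n; exact: lesim1_0.
- move=> a1 b1 a2 b2 [m1 ab1] [m2 ab2]; apply/Lambda_precE.
  exists (maxn m1 m2) => n; apply: lesim1_block; [exact: oplus_corner..| |].
  + exact: lesim_leq (leq_maxl _ _) (ab1 n).
  + exact: lesim_leq (leq_maxr _ _) (ab2 n).
Qed.

(** For (O4), a term of [s + t] is a block sum of a term of [s] and one of [t].
    These lie below terms of some [u n] and some [v m], and both of them below
    terms of [u] and [v] with the common index [maxn n m]. *)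
Lemma Lambda_Qsemigroup : is_Qsemigroup (S := Lambda_pom R) (@Lambda_prec R).
Proof.
split; first exact: Lambda_prec_additive_auxiliary.
- move=> u u_le; have [|z uz] := @is_join_exists (fun n => repr (u n)).
    by move=> n m nm; apply/Lambda_leE; rewrite !reprK; exact: u_le.
  exists (\pi_(Lambda R) z); have := is_join_supremums uz.
  by under eq_fun do rewrite reprK.
- move=> u v s t u_le v_le su tv.
  have [[_ sj] [_ tj]] := (supremums_is_join u_le su, supremums_is_join v_le tv).
  split=> [_ [n _ <-]|w wuv].
    by apply: Lambda_add_le; [apply: su.1 | apply: tv.1]; exists n.
  rewrite -[w]reprK; apply/Lambda_leE => p.
  have [[n [q sq]] [m [r tr]]] := (sj p, tj p).
  have /asboolP/(_ q)[q' qq'] := u_le n (maxn n m) (leq_maxl _ _).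
  have /asboolP/(_ r)[r' rr'] := v_le m (maxn n m) (leq_maxr _ _).
  have : lesim (Tsum (repr (u (maxn n m))) (repr (v (maxn n m)))) (repr w).
    by apply/Lambda_leE; rewrite reprK; apply: wuv; exists (maxn n m).
  move=> /(_ (maxn q' r'))[k qrk]; exists k; apply: lesim1_trans qrk.
  apply: lesim1_block; [exact: oplus_corner..| |].
  + exact: lesim1_trans sq (lesim_leq (leq_maxl _ _) qq').
  + exact: lesim1_trans tr (lesim_leq (leq_maxr _ _) rr').
Qed.

(** A supremum of a weakly increasing sequence in [S_ R] is also the supremum of
    an increasing sequence [y] such that each [y m] is eventually below [x n]. So
    each term of the supremum lies below a term of some [y m], hence below a term
    of some [x n], and [calS_is_join] applies. *)
Lemma Lambda_SQ_object :
  is_SQ_object (S := Lambda_pom R) (@Lambda_prec R) (@S_ R).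
Proof.
split; first exact: Lambda_Qsemigroup.
- exists (Tzero R) => // n; exists (Minf0 R).
  by apply: Minf_ext => i j; rewrite (@Minf_mulE _ 0%N) ?big_nil//;
    right => ? ? /=; rewrite eqxx.
- by move=> _ _ [x xS <-] [y yS <-]; exact: S_add_pi.
- move=> x s xS [y [s' [y_le ys' yx xs']]] xs.
  have s's : s' = s :> Lambda R.
    apply/le_anti/andP; split.
      apply: ys'.2 => _ [m _ <-]; have [k ykx] := yx m.
      by apply: le_trans (ykx k (leqnn k)) _; apply: xs.1; exists k.
    by apply: xs.2 => _ [n _ <-]; exact: xs'.
  have /choice[X XS] : forall n, exists X : Tseq R, calS X /\ \pi_(Lambda R) X = x n.
    by move=> n; have [X ? ?] := xS n; exists X.
  have [_ yj] := supremums_is_join y_le ys'.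
  have Xs : is_join X (repr s).
    split=> [n|p].
      by apply/Lambda_leE; rewrite reprK (XS n).2; apply: xs.1; exists n.
    have [m [q pq]] := yj p; have [n ynx] := yx m.
    have : lesim (repr (y m)) (X n).
      by apply/Lambda_leE; rewrite reprK (XS n).2; exact: ynx.
    move=> /(_ q)[r qr]; exists n, r; rewrite -s's.
    exact: lesim1_trans pq qr.
  have [w wS wz] := calS_is_join (fun n => (XS n).1) Xs.
  by exists w => //; rewrite -[s]reprK; apply/Lambda_eqP.
Qed.

End Joins.

(** * Functoriality *)

Section Functoriality.
Local Open Scope classical_set_scope.
Local Open Scope ring_scope.

Lemma Minf_map_block (R R' : rngType) (f : rng_hom R R') N (x y : Minf R) :
  Minf_map f (block N x y) = block N (Minf_map f x) (Minf_map f y).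
Proof.
apply: Minf_ext => i j /=; rewrite /block_fun.
by case: ifP => // _; case: ifP => // _; rewrite rng_hom0.
Qed.

Lemma Tmap_lesim (R R' : rngType) (f : rng_hom R R') (x y : Tseq R) :
  lesim x y -> lesim (Tmap f x) (Tmap f y).
Proof.
by move=> xy n; have [m nm] := xy n; exists m; exact: Minf_map_lesim1.
Qed.

Definition Lambda_map (R R' : rngType) (f : rng_hom R R') (a : Lambda R) :
  Lambda R' := \pi_(Lambda R') (Tmap f (repr a)).

Lemma Lambda_map_pi (R R' : rngType) (f : rng_hom R R') (x : Tseq R) :
  Lambda_map f (\pi_(Lambda R) x) = \pi_(Lambda R') (Tmap f x).
Proof.
by apply/Lambda_eqP; have [? ?] := lesim_repr x; split; exact: Tmap_lesim.
Qed.

Lemma Lambda_map_morphism (R R' : rngType) (f : rng_hom R R') :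
  @is_SQ_morphism (MkSQ (Lambda_SQ_object R)) (MkSQ (Lambda_SQ_object R'))
    (Lambda_map f).
Proof.
split.
- rewrite /= Lambda_map_pi; apply: eq_pi => n; apply: Minf_ext => i j /=.
  exact: rng_hom0.
- move=> a b; rewrite /= /Lambda_map.
  rewrite -/(Lambda_map f (Lambda_add a b)) Lambda_map_pi; apply/esym.
  apply: pi_block => n; last by rewrite /= Minf_map_block.
  exact/Minf_map_corner/oplus_corner.
- move=> a b [m ab]; apply/Lambda_precE; exists m => n.
  exact: Minf_map_lesim1.
- move=> u s u_le us; have [su sj] := supremums_is_join u_le us.
  suff: is_join (fun n => Tmap f (repr (u n))) (Tmap f (repr s)).
    exact: is_join_supremums.
  split=> [n|p]; first exact: Tmap_lesim.
  by have [n [q pq]] := sj p; exists n, q; exact: Minf_map_lesim1.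
- move=> _ [_ [x xS <-] <-]; exists (Tmap f x); last by rewrite -Lambda_map_pi.
  move=> n; have [y yE] := xS n; exists (Minf_map f y).
  by rewrite /= {1}yE !Minf_mapM.
Qed.

End Functoriality.

Theorem theorem6p4 :
  exists SQ_obP : forall R : rngType,
    is_SQ_object (S := Lambda_pom R) (@Lambda_prec R) (@S_ R),
  let SQ_ob : Rings -> SQ := fun R : rngType => MkSQ (SQ_obP R) in
  exists SQ_mor : forall R R' : Rings, hom R R' -> hom (SQ_ob R) (SQ_ob R'),
    is_functor SQ_mor /\
    (forall (R R' : rngType) (f : rng_hom R R') (x : Tseq R),
      SQ_fun (SQ_mor R R' f) (\pi_(Lambda R) x) = \pi_(Lambda R') (Tmap f x)).
Proof.
exists Lambda_SQ_object => SQ_ob.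
exists (fun (R R' : rngType) (f : rng_hom R R') => MkSQHom (Lambda_map_morphism f)).
split; last by move=> R R' f x; exact: Lambda_map_pi.
split=> [R|R1 R2 R3 g f]; apply: SQ_hom_ext => a /=.
- rewrite -[RHS]reprK; apply: eq_pi => n; exact: Minf_ext.
- by rewrite -[a]reprK; move: (repr a) => x; rewrite (Lambda_map_pi f) !Lambda_map_pi;
  apply: eq_pi => n; apply: Minf_ext => i j.
Qed.
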